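(* For every positive integer $c$ there exists a rational Lie algebra $\mathfrak{n}^{\mathbb{Q}}$ of nilpotency class $c$ and an Anosov automorphism $f:\mathfrak{n}^{\mathbb{Q}}\to\mathfrak{n}^{\mathbb{Q}}$ with $\min(\mathrm{sg}(f))=c$.
   Context: The lower central series is $\gamma_1(\mathfrak{n})=\mathfrak{n}$, $\gamma_i(\mathfrak{n})=[\mathfrak{n},\gamma_{i-1}(\mathfrak{n})]$; $\mathfrak{n}$ has nilpotency class $c$ if $\gamma_{c+1}(\mathfrak{n})=0\neq\gamma_c(\mathfrak{n})$. An automorphism of a rational Lie algebra is Anosov if it is hyperbolic (no eigenvalue of absolute value $1$) and integer-like (characteristic polynomial with integer coefficients and determinant $\pm1$). Its signature $\mathrm{sg}(f)$ is the set $\{p,q\}$ with $p$ the number of eigenvalues (with multiplicity) of absolute value $<1$ and $q$ the number of absolute value $>1$. *)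

(* Defs.v *)
From HB Require Import structures.
From mathcomp Require Import all_boot all_order all_algebra all_field.
Set Implicit Arguments. Unset Strict Implicit. Unset Printing Implicit Defensive.
Import Order.TTheory GRing.Theory Num.Theory.
Local Open Scope ring_scope.

Definition is_lie_bracket (n : nat) (br : 'rV[rat]_n -> 'rV[rat]_n -> 'rV[rat]_n) : Prop :=
  [/\ (forall a x y z, br (a *: x + y) z = a *: br x z + br y z),
      (forall a x y z, br x (a *: y + z) = a *: br x y + br x z),
      (forall x, br x x = 0)
    & (forall x y z, br x (br y z) + br y (br z x) + br z (br x y) = 0)].

(* Lower central series: gamma 1 = n, gamma (k+1) = [n, gamma k]
   (the Q-span of the brackets [x, y] with y in gamma k). *)
Inductive lcs (n : nat) (br : 'rV[rat]_n -> 'rV[rat]_n -> 'rV[rat]_n)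
  : nat -> 'rV[rat]_n -> Prop :=
| lcs_base v : lcs br 1 v
| lcs_zero k : lcs br k.+2 0
| lcs_add k u v : lcs br k.+2 u -> lcs br k.+2 v -> lcs br k.+2 (u + v)
| lcs_scale k (a : rat) v : lcs br k.+2 v -> lcs br k.+2 (a *: v)
| lcs_br k x y : lcs br k.+1 y -> lcs br k.+2 (br x y).

Definition nilpotency_class (n : nat) (br : 'rV[rat]_n -> 'rV[rat]_n -> 'rV[rat]_n)
  (c : nat) : Prop :=
  (forall v, lcs br c.+1 v -> v = 0) /\ (exists2 v, lcs br c v & v != 0).

Definition is_lie_automorphism (n : nat) (br : 'rV[rat]_n -> 'rV[rat]_n -> 'rV[rat]_n)
  (A : 'M[rat]_n) : Prop :=
  A \in unitmx /\ (forall u v, br (u *m A) (v *m A) = br u v *m A).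

Definition eigenvalues_list (n : nat) (A : 'M[rat]_n) (rs : seq algC) : Prop :=
  map_poly (ratr : rat -> algC) (char_poly A) = \prod_(z <- rs) ('X - z%:P).

Definition integer_like (n : nat) (A : 'M[rat]_n) : Prop :=
  char_poly A \is a polyOver Num.int /\ (\det A = 1 \/ \det A = -1).

Definition hyperbolic (n : nat) (A : 'M[rat]_n) : Prop :=
  forall rs, eigenvalues_list A rs -> forall z, z \in rs -> `|z| != 1.

Definition anosov (n : nat) (A : 'M[rat]_n) : Prop :=
  hyperbolic A /\ integer_like A.

(* sg(f) = {p, q}; p = #eigenvalues with |z| < 1, q = #with |z| > 1
   (with multiplicity).  min(sg f) = minn p q. *)
Definition sg_p (rs : seq algC) : nat := count (fun z => `|z| < 1) rs.
Definition sg_q (rs : seq algC) : nat := count (fun z => 1 < `|z|) rs.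

Definition min_signature (n : nat) (A : 'M[rat]_n) (m : nat) : Prop :=
  (exists rs, eigenvalues_list A rs) /\
  forall rs, eigenvalues_list A rs -> minn (sg_p rs) (sg_q rs) = m.

(* Main.v *)
(** Let F = Q(nu) with nu^2 = 3 nu - 1, and L = F[u] with u^2 = a u - nu.  The Lie
    algebra is a form over F, split by L, of the positive part of the affine Lie
    algebra of sl_2, truncated in height > c and seen over Q: its layer of height
    2 i + 1 is L t^i, its layer of height 2 i + 2 is F t^i, with brackets
    [v, w] = v w^bar - v^bar w (divided by u - u^bar) and [z, v] = t z (u - u^bar) v.
    Multiplication by u on the first layer extends to an automorphism acting by
    nu^i u on L t^i and by nu^(i+1) on F t^i.

    Let w > 2 be the large real root of x^2 - 3 x + 1 and take a = (3 - nu)^c.  Where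
    nu is 1/w, u and u^bar have sum w^c and product 1/w, so one is small and the other
    exceeds w^(c-1), so that w^(-i) times it stays > 1 for i < c.  Where nu is w, they have sum
    w^(-c) and product w, so both exceed 1.  Hence each of the c layers carries exactly
    one eigenvalue of modulus < 1. *)

Require Import Defs.
From HB Require Import structures.
From mathcomp Require Import all_boot all_order all_algebra all_field.
From mathcomp Require Import ring zify.
Set Implicit Arguments. Unset Strict Implicit. Unset Printing Implicit Defensive.
Import Order.TTheory GRing.Theory Num.Theory.
Local Open Scope ring_scope.

(** * The quadratic ring generated by [nu] over the rationals *)

(* The pair (x, y) stands for x + y nu, where nu^2 = 3 nu - 1. *)
Definition quad : Type := (rat * rat)%type.
HB.instance Definition _ := GRing.Zmodule.copy quad (rat * rat)%type.

Lemma quadD (x y : quad) : x + y = (x.1 + y.1, x.2 + y.2) :> quad. Proof. by []. Qed.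

Definition quad_one : quad := (1, 0).
Definition quad_mul (x y : quad) : quad :=
  (x.1 * y.1 - x.2 * y.2, x.1 * y.2 + x.2 * y.1 + 3 * (x.2 * y.2)).

Lemma quad_mulA : associative quad_mul.
Proof. by move=> x y z; rewrite /quad_mul /=; congr pair; ring. Qed.
Lemma quad_mulC : commutative quad_mul.
Proof. by move=> x y; rewrite /quad_mul /=; congr pair; ring. Qed.
Lemma quad_mul1 : left_id quad_one quad_mul.
Proof. by case=> a b; rewrite /quad_mul /=; congr pair; ring. Qed.
Lemma quad_mulDl : left_distributive quad_mul +%R.
Proof. by move=> x y z; rewrite !quadD /quad_mul /=; congr pair; ring. Qed.
Lemma quad_one_neq0 : quad_one != 0.
Proof. by []. Qed.

HB.instance Definition _ := GRing.Zmodule_isComNzRing.Build quad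
  quad_mulA quad_mulC quad_mul1 quad_mulDl quad_one_neq0.

Lemma quadM (x y : quad) :
  x * y = (x.1 * y.1 - x.2 * y.2, x.1 * y.2 + x.2 * y.1 + 3 * (x.2 * y.2)) :> quad.
Proof. by []. Qed.

Definition nu : quad := (0, 1).
Definition quad_rat (a : rat) : quad := (a, 0).

Fact quad_rat_zmod : zmod_morphism quad_rat.
Proof. by move=> a b; congr pair; rewrite /= subr0. Qed.
Fact quad_rat_monoid : monoid_morphism quad_rat.
Proof. by split=> // a b; rewrite quadM /=; congr pair; ring. Qed.
HB.instance Definition _ := GRing.isZmodMorphism.Build rat quad quad_rat quad_rat_zmod.
HB.instance Definition _ := GRing.isMonoidMorphism.Build rat quad quad_rat quad_rat_monoid.

(** * The bracket and its automorphism over an arbitrary commutative ring *)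

Section Bracket.
Variables (R : comNzRingType) (t a n : R).
Definition triple : Type := (R * R * R)%type.
Implicit Types X Y Z : triple.

Definition tri_add X Y : triple := (X.1.1 + Y.1.1, X.1.2 + Y.1.2, X.2 + Y.2).
Definition tri_scale (k : R) X : triple := (k * X.1.1, k * X.1.2, k * X.2).
(* (p, q, z) stands for the vector p + q u together with the scalar z; the vector
   t z (2 u - a) (p + q u) is expanded with u^2 = a u - n. *)
Definition tri_br X Y : triple :=
  (t * (X.2 * (- a * Y.1.1 - 2 * n * Y.1.2) - Y.2 * (- a * X.1.1 - 2 * n * X.1.2)),
   t * (X.2 * (2 * Y.1.1 + a * Y.1.2) - Y.2 * (2 * X.1.1 + a * X.1.2)),
   X.1.2 * Y.1.1 - X.1.1 * Y.1.2).

Lemma tri_br_linl k X Y Z :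
  tri_br (tri_add (tri_scale k X) Y) Z = tri_add (tri_scale k (tri_br X Z)) (tri_br Y Z).
Proof. rewrite /tri_br /tri_add /tri_scale /=; congr (_, _, _); ring. Qed.

Lemma tri_br_linr k X Y Z :
  tri_br X (tri_add (tri_scale k Y) Z) = tri_add (tri_scale k (tri_br X Y)) (tri_br X Z).
Proof. rewrite /tri_br /tri_add /tri_scale /=; congr (_, _, _); ring. Qed.

Lemma tri_brxx X : tri_br X X = (0, 0, 0).
Proof. rewrite /tri_br /=; congr (_, _, _); ring. Qed.

(** The scalar part cancels because multiplication by 2 u - a has trace 0. In the vector part the
    terms quadratic in the scalars cancel in pairs, and the rest by the three-term relation of an
    alternating form in rank 2. *)
Lemma tri_jacobi X Y Z :
  tri_add (tri_add (tri_br X (tri_br Y Z)) (tri_br Y (tri_br Z X))) (tri_br Z (tri_br X Y))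
  = (0, 0, 0).
Proof. rewrite /tri_br /tri_add /=; congr (_, _, _); ring. Qed.

(** Multiplication by u on vectors, u (p + q u) = - n q + (p + a q) u, and by its norm n on scalars,
    after a map [s] that will be the substitution t -> n t. *)
Definition tri_aut (s : R -> R) X : triple :=
  (- n * s X.1.2, s X.1.1 + a * s X.1.2, n * s X.2).

(** Multiplying two vectors by u multiplies their bracket by the norm n. In t z (2 u - a) v the
    scalar contributes a further factor n, which matches [s t = n * t]. *)
Lemma tri_aut_br (s : {rmorphism R -> R}) X Y : s t = n * t -> s a = a -> s n = n ->
  tri_aut s (tri_br X Y) = tri_br (tri_aut s X) (tri_aut s Y).
Proof.
move=> st sa sn; rewrite /tri_aut /tri_br /=.
rewrite !(rmorphD, rmorphN, rmorphM, rmorph_nat, st, sa, sn) /=.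
by congr (_, _, _); ring.
Qed.
End Bracket.

(** * Polynomials modulo a power of X, and their rows of coefficients *)

Section Congruence.
Variable R : comNzRingType.
Implicit Types p q r : {poly R}.

Definition eqmodX d p q := forall i, (i < d)%N -> p`_i = q`_i.

Lemma eqmodX_refl d p : eqmodX d p p. Proof. by []. Qed.
Lemma eqmodX_le d e p q : (d <= e)%N -> eqmodX e p q -> eqmodX d p q.
Proof. by move=> le_de epq i lti; apply: epq; apply: leq_trans le_de. Qed.
Lemma eqmodXD d p q p' q' :
  eqmodX d p q -> eqmodX d p' q' -> eqmodX d (p + p') (q + q').
Proof. by move=> e e' i lti; rewrite !coefD e ?e'. Qed.
Lemma eqmodXN d p q : eqmodX d p q -> eqmodX d (- p) (- q).
Proof. by move=> e i lti; rewrite !coefN e. Qed.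
Lemma eqmodXM d p q p' q' :
  eqmodX d p q -> eqmodX d p' q' -> eqmodX d (p * p') (q * q').
Proof.
move=> e e' i lti; rewrite !coefM; apply: eq_bigr => j _.
by rewrite e ?e' // (leq_ltn_trans _ lti) ?leq_subr // -ltnS.
Qed.
Lemma eqmodX_mulX d p q : eqmodX d p q -> eqmodX d.+1 ('X * p) ('X * q).
Proof. by move=> e [|i] lti; rewrite !coefXM //= e. Qed.

Lemma eqmodX_rVpoly d p : eqmodX d (rVpoly (poly_rV p : 'rV_d)) p.
Proof. by move=> i lti; rewrite (coef_rVpoly_ord _ (Ordinal lti)) mxE. Qed.

Lemma poly_rV_eq d p q : eqmodX d p q -> poly_rV p = poly_rV q :> 'rV_d.
Proof. by move=> e; apply/rowP=> i; rewrite !mxE e. Qed.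

Lemma coef_comp_scaleX (k : R) p i : (p \Po (k *: 'X))`_i = p`_i * k ^+ i.
Proof.
rewrite coef_comp_poly; under eq_bigr => j _ do rewrite exprZn coefZ coefXn.
have [lti|lei] := ltnP i (size p).
  rewrite (bigD1 (Ordinal lti)) //= eqxx mulr1 big1 ?addr0 // => j nej.
  by rewrite eq_sym -val_eqE /= in nej; rewrite (negbTE nej) !mulr0.
rewrite nth_default // mul0r big1 // => j _.
by rewrite gtn_eqF ?mulr0 // (leq_trans (ltn_ord j)).
Qed.
End Congruence.

(** * Restriction of scalars from [quad] to the rationals *)

Section Restriction.
Variable m : nat.

Definition rat_row (v : 'rV[quad]_m) : 'rV[rat]_(m + m) :=
  row_mx (map_mx fst v) (map_mx snd v).
Definition quad_row (v : 'rV[rat]_(m + m)) : 'rV[quad]_m :=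
  \row_i ((lsubmx v 0 i, rsubmx v 0 i) : quad).

Lemma quad_rowK : cancel quad_row rat_row.
Proof.
move=> v; rewrite -[RHS](hsubmxK v) /rat_row.
by congr row_mx; apply/rowP=> i; rewrite !mxE.
Qed.

Lemma rat_rowK : cancel rat_row quad_row.
Proof.
move=> v; apply/rowP=> i; rewrite mxE row_mxKl row_mxKr !mxE.
by case: (v 0 i).
Qed.

Lemma rat_row_lin (k : rat) v w :
  rat_row (quad_rat k *: v + w) = k *: rat_row v + rat_row w.
Proof.
rewrite /rat_row scale_row_mx add_row_mx.
by congr row_mx; apply/rowP=> i; rewrite !mxE quadD quadM /=; ring.
Qed.

(** The block rows hold the coordinates of M and of nu M, since nu (x + y nu) = - y + (x + 3 y)
    nu. *)
Definition restr_mx (M : 'M[quad]_m) : 'M[rat]_(m + m) :=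
  block_mx (map_mx fst M) (map_mx snd M)
    (- map_mx snd M) (map_mx fst M + 3 *: map_mx snd M).

Lemma fst_sum (I : finType) (f : I -> quad) : (\sum_i f i).1 = \sum_i (f i).1.
Proof. exact: (big_morph fst (fun x y => erefl) erefl). Qed.
Lemma snd_sum (I : finType) (f : I -> quad) : (\sum_i f i).2 = \sum_i (f i).2.
Proof. exact: (big_morph snd (fun x y => erefl) erefl). Qed.

Lemma restr_mxE v M : rat_row v *m restr_mx M = rat_row (v *m M).
Proof.
rewrite /rat_row mul_row_block; congr row_mx; apply/rowP=> i; rewrite !mxE.
  by rewrite fst_sum -big_split; apply: eq_bigr => j _; rewrite !mxE quadM /=; ring.
by rewrite snd_sum -big_split; apply: eq_bigr => j _; rewrite !mxE quadM /=; ring.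
Qed.
End Restriction.

(** * The truncated Lie algebra and its nilpotency class *)

Section Truncation.
Variables (c1 c2 : nat) (a : quad).
Hypotheses (le21 : (c2 <= c1)%N) (le12 : (c1 <= c2.+1)%N).

Notation T := (triple {poly quad}).
Notation B := (tri_br 'X a%:P nu%:P).
Notation m := (c1 + c1 + c2)%N.

Definition trunc (X : T) : 'rV[quad]_m :=
  row_mx (row_mx (poly_rV X.1.1) (poly_rV X.1.2)) (poly_rV X.2).
Definition lift (v : 'rV[quad]_m) : T :=
  (rVpoly (lsubmx (lsubmx v)), rVpoly (rsubmx (lsubmx v)), rVpoly (rsubmx v)).

Definition tri_eqmod d1 d2 (X Y : T) :=
  [/\ eqmodX d1 X.1.1 Y.1.1, eqmodX d1 X.1.2 Y.1.2 & eqmodX d2 X.2 Y.2].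

Lemma trunc_eq X Y : tri_eqmod c1 c2 X Y -> trunc X = trunc Y.
Proof. by case=> e1 e2 e3; rewrite /trunc (poly_rV_eq e1) (poly_rV_eq e2) (poly_rV_eq e3). Qed.

Lemma liftK : cancel lift trunc.
Proof. by move=> v; rewrite /trunc /lift /= !rVpolyK !hsubmxK. Qed.

Lemma lift_trunc X : tri_eqmod c1 c2 (lift (trunc X)) X.
Proof.
by rewrite /lift /trunc /= !(row_mxKl, row_mxKr); split; apply: eqmodX_rVpoly.
Qed.

(** The scalar part reads vectors modulo t^c2, whence [c2 <= c1]; the vector part carries a factor t
    and reads scalars only modulo t^(c1-1), whence [c1 <= c2.+1]. *)
Lemma tri_eqmod_br X X' Y Y' :
  tri_eqmod c1 c2 X X' -> tri_eqmod c1 c2 Y Y' -> tri_eqmod c1 c2 (B X Y) (B X' Y').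
Proof.
case=> x1 x2 x3 [y1 y2 y3].
have le1 : (c1 <= c1.-1.+1)%N by lia.
have lep : (c1.-1 <= c1)%N by lia.
have lep2 : (c1.-1 <= c2)%N by lia.
move: (eqmodX_le lep x1) (eqmodX_le lep x2) (eqmodX_le lep2 x3) => *.
move: (eqmodX_le lep y1) (eqmodX_le lep y2) (eqmodX_le lep2 y3) => *.
move: (eqmodX_le le21 x1) (eqmodX_le le21 x2) (eqmodX_le le21 y1) (eqmodX_le le21 y2) => *.
split=> /=.
1,2: apply: (eqmodX_le le1); apply: eqmodX_mulX.
all: by do !(apply: eqmodXD || apply: eqmodXN || apply: eqmodXM || assumption
  || exact: eqmodX_refl).
Qed.

Definition to_row X := rat_row (trunc X).
Definition of_row v := lift (quad_row v).

Lemma of_rowK : cancel of_row to_row.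
Proof. by move=> v; rewrite /to_row /of_row liftK quad_rowK. Qed.

Lemma to_row_lin (k : rat) X Y :
  to_row (tri_add (tri_scale (quad_rat k)%:P X) Y) = k *: to_row X + to_row Y.
Proof.
rewrite /to_row -rat_row_lin /trunc /=; congr rat_row.
by rewrite !mul_polyC !linearP /= !scale_row_mx !add_row_mx.
Qed.

Lemma to_row0 : to_row (0, 0, 0) = 0.
Proof.
rewrite /to_row /trunc /= !linear0 !row_mx0.
by apply/rowP=> i; rewrite !mxE; case: splitP => j _; rewrite !mxE.
Qed.

Lemma to_rowD X Y : to_row (tri_add X Y) = to_row X + to_row Y.
Proof.
rewrite -[to_row X]scale1r -to_row_lin; congr (to_row (tri_add _ _)).
by rewrite rmorph1 /tri_scale !mul1r; case: X => -[].
Qed.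

Definition row_br v w := to_row (B (of_row v) (of_row w)).

(** The bracket descends to the truncation, so identities between polynomial triples carry over to
    rows through [of_rowK]. *)
Lemma row_brE X Y : row_br (to_row X) (to_row Y) = to_row (B X Y).
Proof.
rewrite /row_br /to_row; congr rat_row; apply: trunc_eq.
by rewrite /of_row !rat_rowK; apply: tri_eqmod_br; apply: lift_trunc.
Qed.

Lemma row_br_lie : is_lie_bracket row_br.
Proof.
split=> [k x y z|k x y z|x|x y z]; rewrite -[x]of_rowK.
- by rewrite -[y]of_rowK -[z]of_rowK -to_row_lin !row_brE tri_br_linl to_row_lin.
- by rewrite -[y]of_rowK -[z]of_rowK -to_row_lin !row_brE tri_br_linr to_row_lin.
- by rewrite row_brE tri_brxx to_row0.
- by rewrite -[y]of_rowK -[z]of_rowK !row_brE -!to_rowD tri_jacobi to_row0.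
Qed.

(* Vectors times t^i have height 2 i + 1 and scalars times t^i have height 2 i + 2. *)
Lemma lcs_height k v : lcs row_br k v ->
  exists2 X, v = to_row X & tri_eqmod k./2 (k.-1)./2 X (0, 0, 0).
Proof.
elim=> {k v} [v|k|k u v _ [X -> [X1 X2 X3]] _ [Y -> [Y1 Y2 Y3]]
  |k b v _ [X -> [X1 X2 X3]]|k x y _ [Y -> [Y1 Y2 Y3]]].
- by exists (of_row v); rewrite ?of_rowK.
- by exists (0, 0, 0); rewrite ?to_row0.
- exists (tri_add X Y); first by rewrite to_rowD.
  by split=> i lti; rewrite coefD ?X1 ?X2 ?X3 ?Y1 ?Y2 ?Y3 //= !coef0 addr0.
- exists (tri_add (tri_scale (quad_rat b)%:P X) (0, 0, 0)).
    by rewrite to_row_lin to_row0 addr0.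
  by split=> i lti; rewrite coefD coefCM ?X1 ?X2 ?X3 //= !coef0 mulr0 addr0.
- exists (B (of_row x) Y); first by rewrite -row_brE of_rowK.
  have mul0 d p q : eqmodX d q 0 -> eqmodX d (p * q) (0 : {poly quad}).
    by move=> e; rewrite -(mulr0 p); apply: eqmodXM.
  have add0 d p q : eqmodX d p 0 -> eqmodX d q 0 -> eqmodX d (p - q) (0 : {poly quad}).
    by move=> e e'; rewrite -(subr0 0); apply: eqmodXD => //; apply: eqmodXN.
  have add0' d p q : eqmodX d p 0 -> eqmodX d q 0 -> eqmodX d (p + q) (0 : {poly quad}).
    by move=> e e'; rewrite -(addr0 0); apply: eqmodXD.
  have mulX0 d p : eqmodX d p 0 -> eqmodX d.+1 ('X * p) (0 : {poly quad}).
    by move=> e; rewrite -(mulr0 'X); apply: eqmodX_mulX.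
  (* The vector part gains one degree from the factor t, so vanishing below [k./2] is enough
     there. *)
  have le1 : (k./2 <= (k.+1)./2)%N by lia.
  have Z1 := eqmodX_le le1 Y1; have Z2 := eqmodX_le le1 Y2.
  split; rewrite /= -/(uphalf _).
  + by apply/mulX0/add0; [apply/mul0/add0; apply: mul0|rewrite mulrC; apply: mul0].
  + by apply/mulX0/add0; [apply/mul0/add0'; apply: mul0|rewrite mulrC; apply: mul0].
  + by apply/add0; apply: mul0.
Qed.

(** Bracket repeatedly with the vector 1, starting from 2 u - a: [1, p + q u] = - q and [1, z] = - t
    z (2 u - a), so two brackets multiply by 2 t. *)
Lemma lcs_witness i :
  lcs row_br i.*2.+1 (to_row (((- a * 2 ^+ i)%:P * 'X^i, (2 * 2 ^+ i)%:P * 'X^i, 0)))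
  /\ lcs row_br i.*2.+2 (to_row (0, 0, (- (2 ^+ i.+1))%:P * 'X^i)).
Proof.
pose e : T := (1, 0, 0).
have step j :
    lcs row_br j.*2.+1 (to_row (((- a * 2 ^+ j)%:P * 'X^j, (2 * 2 ^+ j)%:P * 'X^j, 0))) ->
    lcs row_br j.*2.+2 (to_row (0, 0, (- (2 ^+ j.+1))%:P * 'X^j)).
  move=> h; have := lcs_br (to_row e) h; rewrite row_brE /e /tri_br /=.
  set X := (_, _, _); suff -> : X = (0, 0, (- 2 ^+ j.+1)%:P * 'X^j) by [].
  by rewrite /X exprS; congr (_, _, _); rewrite ?rmorphN ?rmorphM /=; ring.
suff h : lcs row_br i.*2.+1 (to_row (((- a * 2 ^+ i)%:P * 'X^i, (2 * 2 ^+ i)%:P * 'X^i, 0))).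
  by split=> //; apply: step.
elim: i => [|i IH]; first exact: lcs_base.
have := lcs_br (to_row e) (step _ IH); rewrite row_brE /e /tri_br /= doubleS.
set X := (_, _, _); set Y := (_, _, _); suff -> : X = Y by [].
rewrite /X /Y !exprS; congr (_, _, _);
  rewrite ?rmorphN ?rmorphM ?rmorphN ?rmorphM /= ?rmorph_nat; ring.
Qed.

Lemma two_exp_neq0 i : (2 ^+ i : quad) != 0.
Proof.
have -> : (2 ^+ i : quad) = quad_rat (2 ^+ i) by rewrite rmorphXn rmorph_nat.
by apply/negP => /eqP [] /eqP; rewrite expf_eq0 pnatr_eq0 andbF.
Qed.

Lemma to_row_neq0 (X : T) i :
  (i < c1)%N && (X.1.2`_i != 0) || (i < c2)%N && (X.2`_i != 0) -> to_row X != 0.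
Proof.
move=> h; apply/negP => /eqP X0.
have : trunc X = trunc (0, 0, 0).
  by rewrite -[LHS]rat_rowK -[RHS]rat_rowK -!/(to_row _) X0 to_row0.
rewrite /trunc => /eq_row_mx [] /eq_row_mx [_ e1] e2.
case/orP: h => /andP[lti]; [move/rowP/(_ (Ordinal lti)): e1|move/rowP/(_ (Ordinal lti)): e2];
  by rewrite !mxE /= coef0 => ->; rewrite eqxx.
Qed.

(** [c1] and [c2] count the odd and the even heights up to [c]: an element of height above [c]
    truncates to 0, while the witness of height [c] survives. *)
Lemma row_br_class c : c1 = uphalf c -> c2 = c./2 -> (0 < c)%N -> nilpotency_class row_br c.
Proof.
move=> d1 d2 c_gt0; split=> [v /lcs_height [X -> h]|].
  rewrite -to_row0 /to_row; congr rat_row; apply: trunc_eq.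
  by move: h; rewrite /= -d2 -/(uphalf c) -d1.
have [i /orP[]/eqP ci] : exists i, (c == i.*2.+1) || (c == i.*2.+2).
  by exists (c.-1)./2; lia.
- have [h _] := lcs_witness i; rewrite -ci in h; eexists; first exact: h.
  apply: (@to_row_neq0 _ i); apply/orP; left; apply/andP; split; first lia.
  by rewrite /= coefCM coefXn eqxx mulr1 -exprS two_exp_neq0.
- have [_ h] := lcs_witness i; rewrite -ci in h; eexists; first exact: h.
  apply: (@to_row_neq0 _ i); apply/orP; right; apply/andP; split; first lia.
  by rewrite /= coefCM coefXn eqxx mulr1 oppr_eq0 two_exp_neq0.
Qed.

(** * The automorphism as a matrix on the truncation *)

Definition pow_mx d : 'M[quad]_d := diag_mx (\row_(i < d) nu ^+ i).
(** The summand 0 gives the vector block the shape required by [char_poly_quadratic], with X = 0 and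
    Y = [pow_mx c1]. *)
Definition aut_mx : 'M[quad]_m :=
  block_mx (block_mx 0 (pow_mx c1) (- nu *: pow_mx c1) (0 + a *: pow_mx c1)) 0
    0 (nu *: pow_mx c2).
Definition aut : T -> T := tri_aut a%:P nu%:P (comp_poly (nu *: 'X)).

Lemma poly_rV_comp d (p : {poly quad}) :
  poly_rV (p \Po (nu *: 'X)) = poly_rV p *m pow_mx d.
Proof. by apply/rowP=> i; rewrite mul_mx_diag !mxE coef_comp_scaleX. Qed.

Lemma trunc_aut X : trunc (aut X) = trunc X *m aut_mx.
Proof.
rewrite /trunc /aut_mx !mul_row_block !mulmx0 !addr0 !add0r /=.
rewrite -!polyCN !mul_polyC !linearD !linearZ /= !poly_rV_comp.
by rewrite !scalemxAr.
Qed.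

Lemma aut_br X Y : aut (B X Y) = B (aut X) (aut Y).
Proof.
apply: (@tri_aut_br _ _ _ _ (comp_poly (nu *: 'X))); rewrite /= ?comp_polyC //.
by rewrite comp_polyX -mul_polyC.
Qed.

Lemma restr_aut X : to_row X *m restr_mx aut_mx = to_row (aut X).
Proof. by rewrite /to_row restr_mxE -trunc_aut. Qed.

Lemma row_br_aut u v :
  row_br (u *m restr_mx aut_mx) (v *m restr_mx aut_mx) = row_br u v *m restr_mx aut_mx.
Proof. by rewrite -[u]of_rowK -[v]of_rowK !(restr_aut, row_brE) aut_br. Qed.
End Truncation.

(** * Characteristic polynomials of block matrices *)

Section CharPoly.
Variable R : comNzRingType.

Lemma char_poly_ublock d e (A : 'M[R]_d) (B : 'M_(d, e)) (D : 'M_e) :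
  char_poly (block_mx A B 0 D) = char_poly A * char_poly D.
Proof.
rewrite /char_poly -(det_ublock _ (- map_mx polyC B)); congr (\det _).
rewrite /char_poly_mx map_block_mx /= !map_mx0.
by rewrite scalar_mx_block opp_block_mx add_block_mx subr0 add0r.
Qed.

Lemma char_poly_similar d (A B P : 'M[R]_d) :
  \det P = 1 -> A *m P = P *m B -> char_poly A = char_poly B.
Proof.
move=> dP AP; pose P' := map_mx polyC P.
have dP' : \det P' = 1 by rewrite det_map_mx dP.
rewrite /char_poly -[LHS]mulr1 -[RHS]mul1r -{1}dP' -{1}dP' -!det_mulmx.
by congr (\det _); rewrite mulmxBl mulmxBr scalar_mxC -!map_mxM AP.
Qed.

(* Conjugating by [[1, 0], [r, 1]] makes the matrix block triangular, because
   r is a root of x^2 - (r + r') x + r r'. *)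
Lemma char_poly_quadratic d (X Y : 'M[R]_d) (r r' : R) :
  char_poly (block_mx X Y (- (r * r') *: Y) (X + (r + r') *: Y)) =
  char_poly (X + r *: Y) * char_poly (X + r' *: Y).
Proof.
rewrite -(char_poly_ublock _ Y).
apply: (@char_poly_similar _ _ _ (block_mx 1%:M 0 (r%:M) 1%:M)).
  by rewrite det_lblock !det1 mulr1.
rewrite !mulmx_block !mulmx1 !mul1mx !mulmx0 !mul0mx !addr0 ?add0r.
rewrite !mul_mx_scalar !mul_scalar_mx.
by congr block_mx; apply/matrixP=> i j; rewrite !mxE; ring.
Qed.

Lemma char_poly_scale_diag d k (v : 'rV[R]_d) :
  char_poly (k *: diag_mx v) = \prod_(i < d) ('X - (k * v 0 i)%:P).
Proof.
rewrite char_poly_trig; last first.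
  by apply/is_trig_mxP => i j lt; rewrite !mxE -val_eqE /= ltn_eqF ?mulr0.
by apply: eq_bigr => i _; rewrite !mxE eqxx.
Qed.
End CharPoly.

(** * Integrality of the characteristic polynomial *)

Lemma char_poly_int d (A : 'M[rat]_d) :
  (forall i j, A i j \is a Num.int) -> char_poly A \is a polyOver Num.int.
Proof.
move=> Aint; have -> : A = map_mx intr (map_mx Num.floor A).
  by apply/matrixP=> i j; rewrite !mxE floorK.
by rewrite -map_char_poly; apply/polyOverP=> i; rewrite coef_map /= intr_int.
Qed.

Definition quad_int : {pred quad} := [pred x | (x.1 \is a Num.int) && (x.2 \is a Num.int)].

Lemma quad_intM x y : x \in quad_int -> y \in quad_int -> x * y \in quad_int.
Proof.
case/andP=> /= x1 x2 /andP[/= y1 y2]; rewrite quadM; apply/andP; split=> /=.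
  by rewrite rpredB ?rpredM.
by rewrite !rpredD ?rpredM ?rpred_nat.
Qed.

Lemma quad_intX x i : x \in quad_int -> x ^+ i \in quad_int.
Proof. by move=> xZ; elim: i => // i IH; rewrite exprS quad_intM. Qed.

Lemma restr_mx_int d (M : 'M[quad]_d) :
  (forall i j, M i j \in quad_int) -> forall i j, restr_mx M i j \is a Num.int.
Proof.
move=> MZ i j; have M1 k l : (M k l).1 \is a Num.int by case/andP: (MZ k l).
have M2 k l : (M k l).2 \is a Num.int by case/andP: (MZ k l).
rewrite /restr_mx -[i]splitK -[j]splitK.
by case: (split i) => i'; case: (split j) => j';
  rewrite ?(block_mxEul, block_mxEur, block_mxEdl, block_mxEdr) !mxE ?rpredN
    ?rpredD ?rpredM ?rpred_nat.
Qed.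

Lemma aut_mx_int c1 c2 a i j : a \in quad_int -> aut_mx c1 c2 a i j \in quad_int.
Proof.
move=> aZ; have pZ d k l : pow_mx d k l \in quad_int.
  by rewrite !mxE; case: (k == l); rewrite ?mulr1n ?mulr0n // quad_intX.
have nZ : - nu \in quad_int by [].
rewrite /aut_mx -[i]splitK -[j]splitK.
case: (split i) => i'; case: (split j) => j';
  rewrite ?(block_mxEul, block_mxEur, block_mxEdl, block_mxEdr)
    ?[(0 : 'M_(_,_)) _ _]mxE //; last first.
  by rewrite mxE quad_intM.
rewrite -[i']splitK -[j']splitK.
by case: (split i') => k; case: (split j') => l;
  rewrite ?(block_mxEul, block_mxEur, block_mxEdl, block_mxEdr) ?add0r ?[(0 : 'M_(_,_)) _ _]mxE //
    mxE quad_intM.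
Qed.

(** * Complex embeddings of [quad] and the resulting eigenvalues *)

Section Embedding.
Variables (w : algC) (hw : w ^+ 2 = 3 * w - 1).

(* The unused argument is what makes the ring morphism instance inferable. *)
Definition emb of w ^+ 2 = 3 * w - 1 := fun x : quad => ratr x.1 + ratr x.2 * w.

Fact emb_zmod : zmod_morphism (emb hw).
Proof. by move=> x y; rewrite /emb /= !rmorphB /=; ring. Qed.
Fact emb_monoid : monoid_morphism (emb hw).
Proof.
split=> [|x y]; first by rewrite /emb /= rmorph1 rmorph0 mul0r addr0.
rewrite /emb quadM /= rmorphB !rmorphD !rmorphM rmorph_nat /=.
transitivity (ratr x.1 * ratr y.1 + (ratr x.1 * ratr y.2 + ratr x.2 * ratr y.1) * w
  + ratr x.2 * ratr y.2 * w ^+ 2); last by ring.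
by rewrite hw; ring.
Qed.
HB.instance Definition _ := GRing.isZmodMorphism.Build quad algC (emb hw) emb_zmod.
HB.instance Definition _ := GRing.isMonoidMorphism.Build quad algC (emb hw) emb_monoid.

Lemma emb_nu : emb hw nu = w.
Proof. by rewrite /emb /= rmorph0 rmorph1; ring. Qed.

Definition geom (u : algC) d := [seq u * w ^+ i | i <- iota 0 d].

Lemma big_geom (R : comNzRingType) (f : algC -> R) u d :
  \prod_(z <- geom u d) f z = \prod_(i < d) f (u * w ^+ i).
Proof.
by rewrite big_map -(big_mkord xpredT (fun i => f (u * w ^+ i))) /index_iota subn0.
Qed.

(** The vector block splits along the roots u, u' of x^2 - a x + nu, and layer i scales both by
    w^i. *)
Lemma char_poly_emb_aut c1 c2 a u u' : u + u' = emb hw a -> u * u' = w ->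
  char_poly (map_mx (emb hw) (aut_mx c1 c2 a)) =
  \prod_(z <- geom u c1 ++ geom u' c1 ++ geom w c2) ('X - z%:P).
Proof.
move=> su pu; rewrite /aut_mx; pose D d : 'M_d := diag_mx (\row_(i < d) w ^+ i).
have mD d : map_mx (emb hw) (pow_mx d) = D d.
  apply/matrixP=> i j; rewrite !mxE rmorphMn /= rmorphXn /=.
  by rewrite emb_nu.
rewrite !map_block_mx !map_mx0 map_mxD !map_mxZ map_mx0 !mD rmorphN /= emb_nu.
rewrite char_poly_ublock -su -{1}pu char_poly_quadratic !add0r !char_poly_scale_diag.
rewrite !big_cat /= !big_geom mulrA.
by congr (_ * _ * _); apply: eq_bigr => i _; rewrite mxE.
Qed.
End Embedding.

(** [restr_mx] has the shape of [char_poly_quadratic] with r, r' the conjugates of nu, of sum 3 and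
    product 1; X + w Y is then the image of [M] under nu -> w. *)
Lemma char_poly_restr d (M : 'M[quad]_d) w w'
  (hw : w ^+ 2 = 3 * w - 1) (hw' : w' ^+ 2 = 3 * w' - 1) : w + w' = 3 -> w * w' = 1 ->
  map_poly (ratr : rat -> algC) (char_poly (restr_mx M)) =
  char_poly (map_mx (emb hw) M) * char_poly (map_mx (emb hw') M).
Proof.
move=> s p; rewrite map_char_poly /restr_mx map_block_mx.
pose X := map_mx (ratr : rat -> algC) (map_mx fst M).
pose Y := map_mx (ratr : rat -> algC) (map_mx snd M).
have eX v (hv : v ^+ 2 = 3 * v - 1) : map_mx (emb hv) M = X + v *: Y.
  by apply/matrixP=> i j; rewrite !mxE /emb mulrC.
rewrite !eX -char_poly_quadratic s p map_mxN map_mxD map_mxZ rmorph_nat.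
by rewrite scaleN1r.
Qed.

(** * Moduli of the roots of the quadratics *)

Lemma nu_root_exists : exists2 w : algC, 2 < w & w ^+ 2 = 3 * w - 1.
Proof.
have s2 : sqrtC 5 ^+ 2 = 5 :> algC by rewrite sqrtCK.
have s1 : 1 < sqrtC 5 :> algC
  by rewrite -[X in X < _]sqrtC1 ltr_sqrtC ?qualifE /= ?ler0n ?ler01 ?ltr1n.
exists ((3 + sqrtC 5) / 2).
  by rewrite ltr_pdivlMr ?ltr0n // (_ : 2 * 2 = 3 + 1) ?ltrD2l //; ring.
have n4 : (4 : algC) != 0 by rewrite pnatr_eq0.
apply: (mulfI n4).
transitivity (9 + 6 * sqrtC 5 + sqrtC 5 ^+ 2 : algC); first by field.
by rewrite s2; field.
Qed.

Lemma quadratic_roots (s p : algC) : exists r r', r + r' = s /\ r * r' = p.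
Proof.
pose d := sqrtC (s ^+ 2 - 4 * p); exists ((s + d) / 2), ((s - d) / 2).
split; first by field.
transitivity ((s ^+ 2 - d ^+ 2) / 4); first by field.
by rewrite sqrtCK; field.
Qed.

(** The larger root has modulus at least half the sum, hence above w^N because w > 2. As the product
    has modulus below 1, the other root must be small. *)
Lemma roots_big_sum (w : algC) N : 2 < w -> exists r r',
  [/\ r + r' = w ^+ N.+1, r * r' = w^-1, `|r| < 1 & w ^+ N < `|r'|].
Proof.
move=> w2; have w1 : 1 < w by apply: lt_trans w2; rewrite ltr1n.
have w0 : 0 < w by apply: lt_trans w1.
have [r [r' [hs hp]]] := quadratic_roots (w ^+ N.+1) w^-1.
wlog le : r r' hs hp / `|r| <= `|r'|.
  move=> H; case: (real_leP (normr_real r) (normr_real r')) => [|/ltW] le; first exact: (H r r').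
  by apply: (H r' r) => //; rewrite 1?addrC 1?mulrC.
have r'N : w ^+ N < `|r'|.
  rewrite -(ltr_pM2l (_ : 0 < 2)) ?ltr0n //; apply: (@lt_le_trans _ _ (w ^+ N.+1)).
    by rewrite exprS ltr_pM2r ?exprn_gt0.
  have -> : w ^+ N.+1 = `|r + r'| by rewrite hs ger0_norm // exprn_ge0 // ltW.
  by apply: le_trans (ler_normD _ _) _; rewrite mulr_natl mulr2n lerD2r.
exists r, r'; split=> //; rewrite real_ltNge ?normr_real ?real1 //; apply/negP=> r1.
have : `|r| * `|r'| < 1 by rewrite -normrM hp gtr0_norm ?invr_gt0 // invf_lt1.
rewrite real_ltNge ?realM ?normr_real ?real1 // => /negP[]; rewrite mulr_ege1 //.
by rewrite (le_trans _ (ltW r'N)) // exprn_ege1 // ltW.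
Qed.

(** If |r| <= 1, then w = |r| |r'| <= |r'| <= w^-N + |r| <= 2, against w > 2. *)
Lemma roots_small_sum (w r r' : algC) N :
  2 < w -> r + r' = w ^- N -> r * r' = w -> 1 < `|r|.
Proof.
move=> w2 hs hp; have w1 : 1 < w by apply: lt_trans w2; rewrite ltr1n.
have w0 : 0 < w by apply: lt_trans w1.
rewrite real_ltNge ?normr_real ?real1 //; apply/negP=> r1.
have : w < w; last by rewrite ltxx.
apply: le_lt_trans w2; rewrite -[w]gtr0_norm // -hp normrM.
apply: (@le_trans _ _ `|r'|); first by rewrite ler_piMl.
have -> : r' = w ^- N - r by rewrite -hs addrC addKr.
apply: le_trans (ler_normB _ _) _; rewrite [X in _ <= X]mulr2n lerD //.
by rewrite gtr0_norm ?invr_gt0 ?exprn_gt0 // invf_le1 ?exprn_gt0 // exprn_ege1 // ltW.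
Qed.

(** * Signature and determinant from a list of eigenvalues *)

Definition all_small (rs : seq algC) := all (fun z => `|z| < 1) rs.
Definition all_big (rs : seq algC) := all (fun z => 1 < `|z|) rs.

Lemma sg_small rs : all_small rs -> sg_p rs = size rs /\ sg_q rs = 0%N.
Proof.
move=> h; split; first by apply/eqP; rewrite -all_count.
apply/eqP; rewrite -leqn0 leqNgt -has_count -all_predC.
by apply: sub_all h => z /= h; rewrite lt_gtF.
Qed.

Lemma sg_big rs : all_big rs -> sg_p rs = 0%N /\ sg_q rs = size rs.
Proof.
move=> h; split; last by apply/eqP; rewrite -all_count.
apply/eqP; rewrite -leqn0 leqNgt -has_count -all_predC.
by apply: sub_all h => z /= h; rewrite lt_gtF.
Qed.

(** A factorisation into linear factors is unique up to permutation, so a single list settles the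
    claims about every list of eigenvalues. *)
Lemma signature_criterion n (A : 'M[rat]_n) ss bs :
  map_poly (ratr : rat -> algC) (char_poly A) = \prod_(z <- ss ++ bs) ('X - z%:P) ->
  all_small ss -> all_big bs -> (size ss <= size bs)%N ->
  hyperbolic A /\ min_signature A (size ss).
Proof.
move=> eA hs hb le.
have uniqA rs : eigenvalues_list A rs -> perm_eq rs (ss ++ bs).
  by rewrite /eigenvalues_list eA => /prod_XsubC_eq; rewrite perm_sym.
split=> [rs /uniqA/perm_mem eq z|].
  by rewrite eq mem_cat => /orP[/(allP hs) /lt_eqF ->|/(allP hb) /gt_eqF ->].
split=> [|rs /uniqA e]; first by exists (ss ++ bs).
have [ps qs] := sg_small hs; have [pb qb] := sg_big hb.
have /permP e' := e; have -> : sg_p rs = size ss.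
  by rewrite [sg_p rs]e' count_cat [count _ ss]ps [count _ bs]pb addn0.
have -> : sg_q rs = size bs by rewrite [sg_q rs]e' count_cat [count _ ss]qs [count _ bs]qb.
exact/minn_idPl.
Qed.

(** Compare constant coefficients; the signs agree because the list has [n] entries. *)
Lemma det_eigenvalues n (A : 'M[rat]_n) rs :
  eigenvalues_list A rs -> \prod_(z <- rs) z = 1 -> \det A = 1.
Proof.
move=> eA p1; have sz : size rs = n.
  apply: succn_inj; rewrite -(size_char_poly A) -(size_prod_XsubC rs idfun) -eA.
  by rewrite size_map_poly.
have := congr1 (fun p : {poly algC} => p`_0) eA.
rewrite coef_map /= char_poly_det coef0_prod_XsubC p1 sz rmorphM rmorphXn rmorphN1 /=.
have nz : (-1) ^+ n != 0 :> algC by rewrite signr_eq0.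
by move/(mulfI nz) => e; apply: (fmorph_inj (ratr : rat -> algC)); rewrite /= e rmorph1.
Qed.

Lemma prod_geom_inv (w : algC) d : w != 0 ->
  (\prod_(i < d) w ^+ i) * (\prod_(i < d) w^-1 ^+ i) = 1.
Proof.
move=> w0; rewrite -big_split big1 //= => i _.
by rewrite -exprMn divff // expr1n.
Qed.

Lemma prod_geomE (w u : algC) d : \prod_(z <- geom w u d) z = u ^+ d * \prod_(i < d) w ^+ i.
Proof. by rewrite big_geom big_split /= prodr_const card_ord. Qed.

Lemma all_small_geom (w u : algC) d : `|u| < 1 -> 0 <= w <= 1 -> all_small (geom w u d).
Proof.
move=> u1 /andP[w0 w1]; apply/allP=> _ /mapP[i _ ->].
rewrite normrM normrX (ger0_norm w0); apply: le_lt_trans u1.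
by rewrite ler_piMr ?normr_ge0 // exprn_ile1.
Qed.

Lemma all_big_geom (w u : algC) d : 1 < `|u| -> 1 <= w -> all_big (geom w u d).
Proof.
move=> u1 w1; have w0 : 0 <= w by apply: le_trans w1.
apply/allP=> _ /mapP[i _ ->]; rewrite normrM normrX (ger0_norm w0); apply: (lt_le_trans u1).
by rewrite ler_peMr ?normr_ge0 // exprn_ege1.
Qed.

Lemma all_big_geom_inv (w u : algC) N d : 1 <= w -> (d <= N.+1)%N -> w ^+ N < `|u| ->
  all_big (geom w^-1 u d).
Proof.
move=> w1 dN uN; have w0 : 0 < w by apply: lt_le_trans w1.
apply/allP=> z /mapP[i]; rewrite mem_iota => /= lti -> {z}.
rewrite normrM exprVn [`|_ ^- _|]gtr0_norm ?invr_gt0 ?exprn_gt0 //.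
rewrite ltr_pdivlMr ?exprn_gt0 // mul1r; apply: le_lt_trans uN.
by apply: ler_weXn2l => //; lia.
Qed.

(** * The spectrum of the automorphism *)

Section Spectrum.
Variables (c : nat) (c_gt0 : (0 < c)%N).
Let c1 := uphalf c.
Let c2 := c./2.
(** Since nu (3 - nu) = 1, this is nu^-c, written so that it visibly lies in Z[nu]. *)
Let a : quad := (3 - nu) ^+ c.
Let A := restr_mx (aut_mx c1 c2 a).

Lemma aut_spectrum : exists ss bs : seq algC,
  [/\ map_poly (ratr : rat -> algC) (char_poly A) = \prod_(z <- ss ++ bs) ('X - z%:P),
      all_small ss, all_big bs, size ss = c & (c <= size bs)%N /\ \prod_(z <- ss ++ bs) z = 1].
Proof.
have [w w2 hw] := nu_root_exists.
have w1 : 1 < w by apply: lt_trans w2; rewrite ltr1n.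
have w0 : 0 < w by apply: lt_trans w1.
have wn0 : w != 0 by rewrite gt_eqF.
have wV : w^-1 = 3 - w.
  by apply: (mulfI wn0); rewrite divff // mulrBr -expr2 hw; ring.
have hwV : w^-1 ^+ 2 = 3 * w^-1 - 1.
  by rewrite wV sqrrB hw; ring.
have embV : emb hwV a = w ^+ c.-1.+1.
  rewrite rmorphXn rmorphB rmorph_nat /= emb_nu wV prednK //; congr (_ ^+ _); ring.
have embW : emb hw a = w ^- c.
  by rewrite rmorphXn rmorphB rmorph_nat /= emb_nu -exprVn wV.
have [r [r' [rs rp r1 rN]]] := roots_big_sum c.-1 w2.
have [t [t' [ts tp]]] := quadratic_roots (w ^- c) w.
have t1 := roots_small_sum w2 ts tp.
have t'1 : 1 < `|t'| by apply: (roots_small_sum (r' := t) (N := c) w2); rewrite 1?addrC 1?mulrC.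
have wV01 : 0 <= w^-1 <= 1 by rewrite invr_ge0 ltW //= invf_le1 // ltW.
have wV1 : `|w^-1| < 1 by rewrite gtr0_norm ?invr_gt0 // invf_lt1.
(* Where nu is w^-1 the eigenvalues come from r, r' and w^-1; where nu is w, from t, t' and w. Only
   the families of r and w^-1 are small, and they have c1 + c2 = c members. *)
pose ss := geom w^-1 r c1 ++ geom w^-1 w^-1 c2.
pose bs := geom w^-1 r' c1 ++ geom w t c1 ++ geom w t' c1 ++ geom w w c2.
exists ss, bs; split.
- rewrite (char_poly_restr _ hwV hw) ?mulVf // ?wV ?subrK //.
  rewrite (@char_poly_emb_aut _ hwV c1 c2 a r r') ?embV //.
  rewrite (@char_poly_emb_aut _ hw c1 c2 a t t') ?embW //.
  by rewrite /ss /bs !big_cat /=; ring.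
- by rewrite /ss /all_small all_cat -!/(all_small _) !all_small_geom.
- have c1N : (c1 <= c.-1.+1)%N by rewrite /c1; lia.
  rewrite /bs /all_big !all_cat -!/(all_big _) (all_big_geom_inv (ltW w1) c1N rN).
  by rewrite !all_big_geom ?(gtr0_norm w0) ?(ltW w1).
- by rewrite /ss size_cat !size_map !size_iota /c1 /c2; lia.
split; first by rewrite /bs !size_cat !size_map !size_iota /c1 /c2; lia.
have g1 := prod_geom_inv c1 wn0; have g2 := prod_geom_inv c2 wn0.
rewrite /ss /bs !big_cat /= !prod_geomE.
set P := \prod_(i < c1) w ^+ i in g1 *; set P' := \prod_(i < c1) _ in g1 *.
set Q := \prod_(i < c2) w ^+ i in g2 *; set Q' := \prod_(i < c2) _ in g2 *.
(* Grouping by conjugates makes everything cancel: r r' = w^-1 against t t' = w, and the powers of w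
   against those of w^-1. *)
transitivity ((r * r') ^+ c1 * (t * t') ^+ c1 * (w^-1 * w) ^+ c2 * (P * P') ^+ 2 * (Q * Q')).
  by rewrite !exprMn; ring.
by rewrite rp tp g1 g2 -!exprMn mulVf // !expr1n !mulr1.
Qed.
End Spectrum.

Theorem theorem3p5 (c : nat) (hc : (0 < c)%N) :
  exists (n : nat) (br : 'rV[rat]_n -> 'rV[rat]_n -> 'rV[rat]_n) (A : 'M[rat]_n),
    [/\ is_lie_bracket br, nilpotency_class br c, is_lie_automorphism br A,
        anosov A & min_signature A c].
Proof.
pose c1 := uphalf c; pose c2 := c./2; pose a : quad := (3 - nu) ^+ c.
have le21 : (c2 <= c1)%N by rewrite /c1 /c2; lia.
have le12 : (c1 <= c2.+1)%N by rewrite /c1 /c2; lia.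
exists (c1 + c1 + c2 + (c1 + c1 + c2))%N, (@row_br c1 c2 a), (restr_mx (aut_mx c1 c2 a)).
have [ss [bs [eA hs hb sc [le prod1]]]] := aut_spectrum hc.
have [|hyp sg] := signature_criterion eA hs hb; first by rewrite sc.
have dA := det_eigenvalues eA prod1.
split.
- exact: row_br_lie.
- exact: row_br_class.
- split; last exact: row_br_aut.
  by rewrite unitmxE dA unitr1.
- split=> //; split; last by left.
  apply: char_poly_int; apply: restr_mx_int => i j; apply: aut_mx_int.
  exact: quad_intX.
- by rewrite -sc.
Qed.
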